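(* Let $q$ be a prime power, $K=\mathbb{F}_q((t^{-1}))$, and let $f\in K\setminus\mathbb{F}_q(t)$ have partial quotients $A_0,A_1,A_2,\dots$ and principal convergents $P_k/Q_k$. Let $k\ge 0$. (1) For every $B\in\mathbb{F}_q[t]$ with $|B|\le|A_{k+1}|$, $$\left|f-\frac{P_{k+1}-BP_k}{Q_{k+1}-BQ_k}\right|=\frac{|B|}{|Q_{k+1}|^2}.$$ (2) If $U/V\in\mathbb{F}_q(t)$ (with $U,V\in\mathbb{F}_q[t]$, $V\neq0$) satisfies $\deg(V)=\deg(Q_{k+1})$ and $$\left|f-\frac UV\right|<\frac{1}{|Q_{k+1}|\cdot|Q_k|},$$ then $$\frac UV=\frac{P_{k+1}-BP_k}{Q_{k+1}-BQ_k}$$ for some $B\in\mathbb{F}_q[t]$ with $|B|<|A_{k+1}|$.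
   Context: $K=\mathbb{F}_q((t^{-1}))$ is the field of formal Laurent series $f=a_nt^n+\dots+a_1t+a_0+a_{-1}t^{-1}+\cdots$ with $a_i\in\mathbb{F}_q$. For such $f$ with $a_n\ne 0$, $\deg(f)=n$ and $|f|=q^{n}$; by convention $\deg(0)=-\infty$ and $|0|=0$. The polynomial part of $f=\sum_{i\le n}a_it^i$ is $[f]=\sum_{0\le i\le n}a_it^i\in\mathbb{F}_q[t]$. The continued fraction expansion of irrational $f$ (that is, $f\in K\setminus\mathbb{F}_q(t)$) is obtained by $A_0=[f]$, $f_0=f-A_0$, $A_{j}=[1/f_{j-1}]$, $f_{j}=1/f_{j-1}-A_{j}$ for $j\ge1$; the $A_j\in\mathbb{F}_q[t]$ are the partial quotients (with $\deg A_j\ge1$ for $j\ge1$). The numerators and denominators of the principal convergents are given by $P_{-1}=1$, $Q_{-1}=0$, $P_0=A_0$, $Q_0=1$, and $P_{j+1}=A_{j+1}P_j+P_{j-1}$, $Q_{j+1}=A_{j+1}Q_j+Q_{j-1}$ for $j\ge0$.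
   Formalization: In (1), B is also assumed nonzero with |A_{k+1}-B|=|A_{k+1}| (automatic if |B|<|A_{k+1}|): for B=0 the right side is 0 though f is irrational, and if the leading terms of B and A_{k+1} cancel, the denominator drops in degree or vanishes, so the equality fails. *)

(* Defs.v *)
From HB Require Import structures.
From mathcomp Require Import all_boot all_order all_algebra.
From mathcomp Require Import zify.
From mathcomp Require Import boolp classical_sets fsbigop.
Set Implicit Arguments.
Unset Strict Implicit.
Unset Printing Implicit Defensive.
Import Order.TTheory GRing.Theory Num.Theory.
Local Open Scope ring_scope.

(* [f i] is the coefficient of t^i; the support is bounded above, so these are
   the elements of F((t^-1)). *)
Record laurent (F : fieldType) := Laurent {
  lcoef :> int -> F;
  _ : exists n : int, forall i : int, n < i -> lcoef i = 0 }.

Section LaurentField.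
Variable F : fieldType.
Implicit Types (f g h : laurent F) (n m l : int) (a b c : nat -> F).

HB.instance Definition _ := gen_eqMixin (laurent F).
HB.instance Definition _ := gen_choiceMixin (laurent F).

Definition upto n (u : int -> F) := forall i : int, n < i -> u i = 0.

Lemma lboundP f : exists n, upto n f.
Proof. by case: f. Qed.

Lemma laurentP f g : (forall i, f i = g i) -> f = g.
Proof.
case: f g => [u hu] [v hv] /= /funext E; subst v.
by congr Laurent; apply: Prop_irrelevance.
Qed.

Lemma ladd_subproof f g : exists n, upto n (fun i => f i + g i).
Proof.
have [n fn] := lboundP f; have [m gm] := lboundP g.
exists (Num.max n m) => i; rewrite gt_max => /andP[ni mi].
by rewrite fn ?gm ?addr0.
Qed.
Definition ladd f g := Laurent (ladd_subproof f g).

Lemma lopp_subproof f : exists n, upto n (fun i => - f i).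
Proof. by have [n fn] := lboundP f; exists n => i /fn ->; rewrite oppr0. Qed.
Definition lopp f := Laurent (lopp_subproof f).

Lemma lzero_subproof : exists n, upto n (fun=> 0).
Proof. by exists 0. Qed.
Definition lzero := Laurent lzero_subproof.

Lemma laddA : associative ladd.
Proof. by move=> f g h; apply: laurentP => i /=; rewrite addrA. Qed.
Lemma laddC : commutative ladd.
Proof. by move=> f g; apply: laurentP => i /=; rewrite addrC. Qed.
Lemma ladd0 : left_id lzero ladd.
Proof. by move=> f; apply: laurentP => i /=; rewrite add0r. Qed.
Lemma laddN : left_inverse lzero lopp ladd.
Proof. by move=> f; apply: laurentP => i /=; rewrite addNr. Qed.
HB.instance Definition _ :=
  GRing.isZmodule.Build (laurent F) laddA laddC ladd0 laddN.

Definition cauchy a b k := \sum_(j < k.+1) a j * b (k - j)%N.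

Lemma cauchyE a b k d : (k <= d)%N ->
  cauchy a b k = ((\poly_(i < d.+1) a i) * (\poly_(i < d.+1) b i))`_k.
Proof.
move=> kd; rewrite coefM; apply: eq_bigr => j _.
have jk := ltn_ord j.
by rewrite !coef_poly !(@ifT _ (_ < _)%N) //; lia.
Qed.

Lemma eq_cauchy a b a' b' k : (forall i, (i <= k)%N -> a i = a' i) ->
  (forall i, (i <= k)%N -> b i = b' i) -> cauchy a b k = cauchy a' b' k.
Proof.
move=> ea eb; apply: eq_bigr => j _; have jk := ltn_ord j.
by rewrite ea ?eb //; lia.
Qed.

Lemma cauchyA a b c k : cauchy a (cauchy b c) k = cauchy (cauchy a b) c k.
Proof.
pose T (u : nat -> F) := \poly_(i < k.+1) u i.
have TE u v i : (i <= k)%N -> (T u * T v)`_i = cauchy u v i.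
  by move=> ik; rewrite (@cauchyE _ _ _ k).
transitivity ((T a * (T b * T c))`_k).
  rewrite coefM; apply: eq_bigr => j _; have jk := ltn_ord j.
  by rewrite TE ?coef_poly ?(@ifT _ (_ < _)%N) //; lia.
rewrite mulrA coefM; apply: eq_bigr => j _; have jk := ltn_ord j.
by rewrite TE ?coef_poly ?(@ifT _ (_ < _)%N) //; lia.
Qed.

Lemma cauchyC a b k : cauchy a b k = cauchy b a k.
Proof. by rewrite !(@cauchyE _ _ _ k) // mulrC. Qed.

Definition conv (u v : int -> F) n := \sum_(i \in [set: int]) u i * v (n - i).

Lemma conv_cauchy n m (u v : int -> F) k : upto n u -> upto m v ->
  conv u v (n + m - k%:Z) =
  cauchy (fun j => u (n - j%:Z)) (fun j => v (m - j%:Z)) k.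
Proof.
move=> un vm; rewrite /conv /cauchy.
pose r := [seq n - (val j)%:Z | j <- enum 'I_k.+1].
rewrite (fsbigE r) //=.
- under eq_bigl do rewrite in_setT.
  rewrite big_map big_enum /=; apply: eq_bigr => j _; have jk := ltn_ord j.
  by congr (_ * v _); lia.
- by rewrite map_inj_uniq ?enum_uniq // => i j e; apply/val_inj; move: e => /=; lia.
- move=> i _ ir; have [/un->|ni] := ltP n i; first by rewrite mul0r.
  rewrite (vm (_ - _)) ?mulr0 //.
  have [kni|nik] := ltnP k `|n - i|%N; first by lia.
  case/negP: ir; apply/mapP; exists (inord `|n - i|%N); first by rewrite mem_enum.
  by rewrite /= inordK; lia.
Qed.

Lemma conv_upto n m (u v : int -> F) :
  upto n u -> upto m v -> upto (n + m) (conv u v).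
Proof.
move=> un vm i nmi; rewrite /conv fsbig1 // => j _.
have [/un->|jn] := ltP n j; first by rewrite mul0r.
by rewrite vm ?mulr0 //; lia.
Qed.

Lemma lmul_subproof f g : exists n, upto n (conv f g).
Proof.
have [n fn] := lboundP f; have [m gm] := lboundP g.
by exists (n + m); apply: conv_upto.
Qed.
Definition lmul f g := Laurent (lmul_subproof f g).

Lemma eq_upto n (u v : int -> F) : upto n u -> upto n v ->
  (forall k : nat, u (n - k%:Z) = v (n - k%:Z)) -> forall i, u i = v i.
Proof.
move=> un vn e i; have [ni|ni] := ltP n i; first by rewrite un ?vn.
by have -> : i = n - `|n - i|%N%:Z by lia.
Qed.

Lemma lmulC : commutative lmul.
Proof.
move=> f g; have [n fn] := lboundP f; have [m gm] := lboundP g.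
apply: laurentP; apply: (@eq_upto (n + m)) => /= [||k].
- exact: conv_upto.
- by rewrite addrC; apply: conv_upto.
- rewrite conv_cauchy // (addrC n) conv_cauchy //; exact: cauchyC.
Qed.

Lemma lmulA : associative lmul.
Proof.
move=> f g h; have [n fn] := lboundP f; have [m gm] := lboundP g.
have [l hl] := lboundP h.
apply: laurentP; apply: (@eq_upto (n + (m + l))) => /= [||k].
- by apply: conv_upto => //; apply: conv_upto.
- by rewrite addrA; apply: conv_upto => //; apply: conv_upto.
- have gh := conv_upto gm hl; have fg := conv_upto fn gm.
  rewrite conv_cauchy // addrA conv_cauchy //=.
  under eq_cauchy do [over | rewrite conv_cauchy //; over].
  rewrite cauchyA.
  by apply: eq_cauchy => // i _; rewrite conv_cauchy.
Qed.

Lemma lmulDl : left_distributive lmul ladd.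
Proof.
move=> f g h; have [n fn] := lboundP f; have [m gm] := lboundP g.
have [l hl] := lboundP h.
have {}fn : upto (Num.max n m) f by move=> i; rewrite gt_max => /andP[/fn].
have {}gm : upto (Num.max n m) g by move=> i; rewrite gt_max => /andP[_ /gm].
have fgn : upto (Num.max n m) (ladd f g).
  by move=> i hi; rewrite /= fn ?gm ?addr0.
apply: laurentP; apply: (@eq_upto (Num.max n m + l)) => [||k] /=.
- exact: conv_upto.
- by move=> i hi; rewrite !(conv_upto (n := Num.max n m) (m := l)) ?addr0.
- rewrite !conv_cauchy // /cauchy -big_split /=.
  by apply: eq_bigr => j _; rewrite mulrDl.
Qed.

Lemma lpoly_subproof (p : {poly F}) :
  exists n, upto n (fun i => if i is Posz k then p`_k else 0).
Proof.
by exists (size p)%:Z => -[k|k] // pk; rewrite nth_default //; apply: ltnW.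
Qed.
Definition lpoly p := Laurent (lpoly_subproof p).

Lemma lmul1 : left_id (lpoly 1) lmul.
Proof.
move=> f; have [n fn] := lboundP f.
have u1 : upto 0 (lpoly 1) by move=> [[|k]|k] //= _; rewrite coef1.
apply: laurentP; apply: (@eq_upto n) => //= [|k].
  by rewrite -[n]add0r; apply: conv_upto.
have -> : n - k%:Z = 0 + n - k%:Z by rewrite add0r.
rewrite conv_cauchy // /cauchy big_ord_recl big1 => [|j _].
  by rewrite /= coef1 mul1r addr0 subn0 add0r.
by rewrite /= mul0r.
Qed.

Lemma lone_neq0 : lpoly 1 != lzero.
Proof.
apply/eqP => /(congr1 (fun f : laurent F => f 0)) /= /eqP.
by rewrite coef1 oner_eq0.
Qed.

HB.instance Definition _ := GRing.Zmodule_isComNzRing.Build (laurent F)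
  lmulA lmulC lmul1 lmulDl lone_neq0.

Lemma coef_lmul f g n : (f * g) n = \sum_(i \in [set: int]) f i * g (n - i).
Proof. by []. Qed.

Lemma coef_lone n : (1 : laurent F) n = (n == 0)%:R.
Proof. by case: n => [k|k] //=; rewrite coef1. Qed.

Definition is_ldeg f (n : int) := f n != 0 /\ upto n f.

Lemma is_ldegP f : f != 0 -> exists n, is_ldeg f n.
Proof.
move=> f0; have [n fn] := lboundP f.
have ex : exists k : nat, f (n - k%:Z) != 0.
  apply: contrapT => nex; move/eqP: f0; apply; apply: laurentP.
  apply: (@eq_upto n) => // k /=; apply: contrapT => /eqP nz.
  by apply: nex; exists k.
exists (n - (ex_minn ex)%:Z); case: ex_minnP => k fk kmin; split=> // i ki.
have [/fn//|ni] := ltP n i; apply/eqP; apply: contraT => fi.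
have := kmin `|n - i|%N; have -> : n - `|n - i|%N%:Z = i by lia.
by move=> /(_ fi); lia.
Qed.

Lemma is_ldeg_inj f n m : is_ldeg f n -> is_ldeg f m -> n = m.
Proof.
move=> [/eqP fn un] [/eqP fm um]; have [/um //|mn] := ltP m n.
by have [/un //|nm] := ltP n m; lia.
Qed.

Fixpoint cauchy_inv_seq a k : seq F :=
  if k is k'.+1 then
    let s := cauchy_inv_seq a k' in
    rcons s ((a 0%N)^-1 *
      ((k' == 0%N)%:R - \sum_(j < k') a j.+1 * s`_(k' - j.+1)))
  else [::].

Lemma cauchy_inv a : a 0%N != 0 ->
  exists b, forall k, cauchy a b k = (k == 0%N)%:R.
Proof.
move=> a0; pose s := cauchy_inv_seq a; exists (fun k => (s k.+1)`_k) => k.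
have szs i : size (s i) = i by elim: i => //= i IH; rewrite size_rcons IH.
have sE i d : (i < d)%N -> (s d)`_i = (s i.+1)`_i.
  elim: d => // d IH; rewrite ltnS leq_eqVlt => /predU1P[->//|id].
  by rewrite {1}/s /= nth_rcons -/s szs id IH.
rewrite /cauchy big_ord_recl subn0 /= nth_rcons -/s szs ltnn eqxx.
rewrite mulrA mulfV // mul1r addrC.
rewrite -[RHS](addrNK (\sum_(j < k) a j.+1 * (s k)`_(k - j.+1))) addrC.
congr (_ + _); apply: eq_bigr => j _; have jk := ltn_ord j.
by rewrite (sE _ k) //= /bump /=; lia.
Qed.

Lemma lmulV_subproof f : f != 0 -> exists g, g * f = 1.
Proof.
move=> /is_ldegP[n [fn un]].
have [|b bP] := @cauchy_inv (fun k => f (n - k%:Z)); first by rewrite subr0.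
pose v (i : int) := if i <= - n then b `|- n - i|%N else 0.
have vn : upto (- n) v by move=> i hi; rewrite /v ifF //; lia.
exists (@Laurent F v (ex_intro _ (- n) vn)); rewrite mulrC.
apply: laurentP; apply: (@eq_upto (n - n)) => [||k].
- exact: conv_upto.
- by rewrite subrr => -[[|k]|k] //= _; rewrite coef1.
- rewrite [LHS]conv_cauchy //; transitivity ((k == 0%N)%:R : F).
    rewrite -bP; apply: eq_cauchy => // i _; rewrite /v /= ifT; last by lia.
    by congr b; lia.
  by rewrite subrr sub0r coef_lone oppr_eq0.
Qed.

(* Inverses are unique, so the choice made by [xget] is immaterial; it returns 0
   when f = 0. *)
Definition linv f := xget 0 [set g | g * f = 1].

Lemma lmulVf f : f != 0 -> linv f * f = 1.
Proof. by move=> /lmulV_subproof; apply: xgetPex. Qed.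

Lemma linv0 : linv 0 = 0.
Proof.
by rewrite /linv xgetPN // => g /= /eqP; rewrite mulr0 eq_sym oner_eq0.
Qed.

HB.instance Definition _ :=
  GRing.ComNzRing_isField.Build (laurent F) lmulVf linv0.

Lemma lpoly_is_zmod_morphism : zmod_morphism lpoly.
Proof.
move=> p q; apply: laurentP => -[k|k]; rewrite /= ?coefB ?subr0 //.
Qed.

Lemma lpoly_is_monoid_morphism : monoid_morphism lpoly.
Proof.
split=> // p q; apply: laurentP => -[k|k]; last first.
  rewrite coef_lmul fsbig1 // => -[i|i] _; last by rewrite mul0r.
  have -> : Negz k - i%:Z = Negz (k + i) by lia.
  by rewrite mulr0.
rewrite coef_lmul (fsbigE [seq (val j)%:Z | j <- enum 'I_k.+1]) //=.
- under eq_bigl do rewrite in_setT.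
  rewrite big_map big_enum /= coefM; apply: eq_bigr => j _.
  by have jk := ltn_ord j; rewrite subzn.
- by rewrite map_inj_uniq ?enum_uniq // => i j e; apply/val_inj; move: e => /=; lia.
- move=> [i|i] _ ir; last by rewrite mul0r.
  have [ki|ik] := ltnP k i.
    have -> : k%:Z - i%:Z = Negz (i - k).-1 by lia.
    by rewrite mulr0.
  case/negP: ir; apply/mapP; exists (inord i); first by rewrite mem_enum.
  by rewrite /= inordK.
Qed.

HB.instance Definition _ := GRing.isZmodMorphism.Build {poly F} (laurent F)
  lpoly lpoly_is_zmod_morphism.
HB.instance Definition _ := GRing.isMonoidMorphism.Build {poly F} (laurent F)
  lpoly lpoly_is_monoid_morphism.

(* For f != 0, the degree of f. The degree -oo of 0 is not represented: the value
   of [ldeg 0] is meaningless and never matters below. *)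
Definition ldeg f : int := xget 0 [set n | is_ldeg f n].

Lemma ldegP f : f != 0 -> is_ldeg f (ldeg f).
Proof. by move=> /is_ldegP; apply: xgetPex. Qed.

(* The polynomial part [f]. When deg f < 0 the range of indices is larger than
   necessary but all the coefficients vanish, see [coef_lfloor]. *)
Definition lfloor f : {poly F} := \poly_(i < `|ldeg f|%N.+1) f i%:Z.

Lemma coef_lfloor f (i : nat) : (lfloor f)`_i = f i%:Z.
Proof.
rewrite coef_poly; case: ltnP => // di.
have [->//|/ldegP[_ un]] := eqVneq f 0; rewrite un //; lia.
Qed.

(* F(t) inside F((t^-1)) *)
Definition rational_laurent : set (laurent F) :=
  [set f | exists U V : {poly F}, V != 0 /\ f = lpoly U / lpoly V].

Fixpoint cf_rem f (j : nat) : laurent F :=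
  if j is j'.+1 then (cf_rem f j')^-1 - lpoly (lfloor (cf_rem f j')^-1)
  else f - lpoly (lfloor f).

Definition cf_pq f (j : nat) : {poly F} :=
  if j is j'.+1 then lfloor (cf_rem f j')^-1 else lfloor f.

(* The sequences P and Q shifted by one: index n stands for P_(n-1), Q_(n-1), so
   that the initial values P_(-1) = 1 and Q_(-1) = 0 sit at index 0. *)
Fixpoint cf_num_shift f (n : nat) : {poly F} :=
  match n with
  | 0 => 1
  | n'.+1 => match n' with
             | 0 => cf_pq f 0
             | m.+1 => cf_pq f n' * cf_num_shift f n' + cf_num_shift f m
             end
  end.

Fixpoint cf_den_shift f (n : nat) : {poly F} :=
  match n with
  | 0 => 0
  | n'.+1 => match n' with
             | 0 => 1
             | m.+1 => cf_pq f n' * cf_den_shift f n' + cf_den_shift f m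
             end
  end.

Definition cf_num f (j : nat) := cf_num_shift f j.+1.
Definition cf_den f (j : nat) := cf_den_shift f j.+1.

End LaurentField.

(* |f| = q^(deg f) with q = #|F|; all its values are rational numbers. *)
Definition labs (F : finFieldType) (f : laurent F) : rat :=
  if f == 0 then 0 else #|F|%:R ^ ldeg f.

Definition pabs (F : finFieldType) (p : {poly F}) : rat := labs (lpoly p).

(* Main.v *)
(* Write r for the k+1-st remainder and P, P', Q, Q' for the numerators and
   denominators of index k, k+1.  Since f = (P' + r P) / (Q' + r Q) and
   P' Q - P Q' = +-1, the error of (P' - B P) / (Q' - B Q) is
   +-(B + r) / ((Q' + r Q) (Q' - B Q)), whose absolute value is read off
   from |r| < 1 and |Q| < |Q'|.
   Conversely, if U/V is so close to f, then the ultrametric inequality applied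
   to f - U/V and to the errors of P/Q and P'/Q' gives |U Q - V P| = 1 and
   |U Q' - V P'| < |Q'| / |Q|; up to sign these are the coordinates of (U, V) in
   the unimodular basis (P', Q'), (P, Q). *)
Require Import Defs.
From mathcomp Require Import all_boot all_order all_algebra.
From mathcomp Require Import zify ring.
From mathcomp Require Import classical_sets.
Set Implicit Arguments.
Unset Strict Implicit.
Import Order.TTheory GRing.Theory Num.Theory.
Local Open Scope ring_scope.

Lemma coef_neq0_laurent (F : fieldType) (f : laurent F) n : f n != 0 -> f != 0.
Proof. by apply: contra => /eqP->. Qed.

Lemma is_ldegM (F : fieldType) (f g : laurent F) n m :
  is_ldeg f n -> is_ldeg g m -> is_ldeg (f * g) (n + m).
Proof.
move=> [fn un] [gm um]; split; last exact: conv_upto.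
have -> : n + m = n + m - 0%:Z by rewrite subr0.
have -> : (f * g) (n + m - 0%:Z) = f n * g m.
  by rewrite [LHS](conv_cauchy 0 un um) /cauchy big_ord1 !subr0.
by rewrite mulf_neq0.
Qed.

Lemma lpoly_eq0 (F : fieldType) (p : {poly F}) : (lpoly p == 0) = (p == 0).
Proof.
apply/eqP/eqP => [p0|->]; last exact: rmorph0.
apply/polyP => i; rewrite coef0.
by have /(congr1 (fun h : laurent F => h i%:Z)) := p0.
Qed.

Lemma lpoly_fracMl (F : fieldType) (B U V : {poly F}) : B != 0 ->
  lpoly (B * U) / lpoly (B * V) = lpoly U / lpoly V.
Proof. by move=> B0; rewrite !rmorphM -mulf_div divff ?lpoly_eq0 // mul1r. Qed.

Section AbsoluteValue.
Variable F : finFieldType.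
Implicit Types (f g : laurent F) (p : {poly F}).

Lemma card_rat_gt1 : (1 : rat) < #|F|%:R.
Proof. by rewrite ltr1n card_finNzRing_gt1. Qed.

Lemma labs0 : labs (0 : laurent F) = 0.
Proof. by rewrite /labs eqxx. Qed.

Lemma labs_eq0 f : (labs f == 0) = (f == 0).
Proof.
rewrite /labs; case: (f == 0); first by rewrite eqxx.
by rewrite expfz_eq0 (gt_eqF (lt_trans ltr01 card_rat_gt1)) andbF.
Qed.

Lemma labs_ge0 f : 0 <= labs f.
Proof. by rewrite /labs; case: ifP => // _; rewrite exprz_ge0. Qed.

Lemma labs_gt0 f : (0 < labs f) = (f != 0).
Proof. by rewrite lt_neqAle labs_ge0 andbT eq_sym labs_eq0. Qed.

Lemma is_ldeg_labs f n : is_ldeg f n -> labs f = #|F|%:R ^ n.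
Proof.
move=> fn; have f0 := coef_neq0_laurent fn.1.
by rewrite /labs (negbTE f0) (is_ldeg_inj (ldegP f0) fn).
Qed.

Lemma labs_ge_coef f n : f n != 0 -> #|F|%:R ^ n <= labs f.
Proof.
move=> fn; have f0 := coef_neq0_laurent fn; rewrite /labs (negbTE f0).
rewrite ler_eXz2l ?card_rat_gt1 // leNgt; apply: contra fn => lt_n.
by rewrite (ldegP f0).2.
Qed.

Lemma labsM f g : labs (f * g) = labs f * labs g.
Proof.
have [->|f0] := eqVneq f 0; first by rewrite mul0r labs0 mul0r.
have [->|g0] := eqVneq g 0; first by rewrite mulr0 labs0 mulr0.
have [df dg] := (ldegP f0, ldegP g0).
rewrite (is_ldeg_labs (is_ldegM df dg)) (is_ldeg_labs df) (is_ldeg_labs dg).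
by rewrite expfzDr // gt_eqF // (lt_trans ltr01 card_rat_gt1).
Qed.

Lemma labs1 : labs (1 : laurent F) = 1.
Proof.
have n0 : labs (1 : laurent F) != 0 by rewrite labs_eq0 oner_eq0.
by apply: (mulfI n0); rewrite -labsM !mulr1.
Qed.

Lemma labsN f : labs (- f) = labs f.
Proof.
have [->|f0] := eqVneq f 0; first by rewrite oppr0.
have [fn un] := ldegP f0.
rewrite (@is_ldeg_labs (- f) (ldeg f)) ?(is_ldeg_labs (ldegP f0)) //.
by split=> [|i /un fi]; rewrite /= ?oppr_eq0 // fi oppr0.
Qed.

Lemma labsV f : labs f^-1 = (labs f)^-1.
Proof.
have [->|f0] := eqVneq f 0; first by rewrite invr0 labs0 invr0.
have n0 : labs f != 0 by rewrite labs_eq0.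
by apply: (mulfI n0); rewrite -labsM !mulfV // labs1.
Qed.

Lemma labs_sign n : labs ((-1) ^+ n : laurent F) = 1.
Proof. by rewrite -signr_odd; case: (odd n); rewrite ?labsN labs1. Qed.

Lemma labsD_max f g : labs (f + g) <= Num.max (labs f) (labs g).
Proof.
have [->|fg0] := eqVneq (f + g) 0; first by rewrite labs0 le_max labs_ge0.
have dfg := ldegP fg0; rewrite (is_ldeg_labs dfg) le_max.
have [fn|fn] := eqVneq (f (ldeg (f + g))) 0; last by rewrite labs_ge_coef.
have [gn|gn] := eqVneq (g (ldeg (f + g))) 0; last by rewrite orbC labs_ge_coef.
by case: dfg; rewrite /= fn gn addr0 eqxx.
Qed.

Lemma labsD_lt f g c : labs f < c -> labs g < c -> labs (f + g) < c.
Proof. by move=> fc gc; rewrite (le_lt_trans (labsD_max f g)) // gt_max fc gc. Qed.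

Lemma labsDr f g : labs g < labs f -> labs (f + g) = labs f.
Proof.
move=> gf; apply/eqP; rewrite eq_le.
rewrite (le_trans (labsD_max f g)) /=; last by rewrite ge_max lexx ltW.
rewrite leNgt; apply/negP => lt_fg.
by have := @labsD_lt (f + g) (- g) _ lt_fg; rewrite labsN addrK ltxx => /(_ gf).
Qed.

Lemma pabsM p p' : pabs (p * p') = pabs p * pabs p'.
Proof. by rewrite /pabs rmorphM labsM. Qed.

Lemma pabs_eq0 p : (pabs p == 0) = (p == 0).
Proof. by rewrite /pabs labs_eq0 lpoly_eq0. Qed.

Lemma pabs_gt0 p : (0 < pabs p) = (p != 0).
Proof. by rewrite labs_gt0 -labs_eq0 -/(pabs p) pabs_eq0. Qed.

Lemma pabs_size p : p != 0 -> pabs p = #|F|%:R ^ (size p).-1%:Z.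
Proof.
move=> p0; apply: is_ldeg_labs; split; first by rewrite /= -/(lead_coef p) lead_coef_eq0.
case=> [i|i] //; rewrite ltz_nat => ip; apply: nth_default.
by rewrite -(prednK (_ : 0 < size p)%N) // size_poly_gt0.
Qed.

Lemma pabs_ge1 p : p != 0 -> 1 <= pabs p.
Proof. by move=> /pabs_size->; rewrite exprn_ege1 // ltW // card_rat_gt1. Qed.

Lemma pabs_polyC c : c != 0 -> pabs (c%:P : {poly F}) = 1.
Proof. by move=> c0; rewrite pabs_size ?polyC_eq0 // size_polyC c0. Qed.

Lemma pabs_eq1 p : pabs p = 1 -> exists2 c, c != 0 & p = c%:P.
Proof.
move=> p1; have p0 : p != 0 by rewrite -pabs_gt0 p1.
have szp : (size p <= 1)%N.
  move: p1; rewrite pabs_size // => /eqP.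
  by rewrite -(expr0z #|F|%:R) eq_le ler_eXz2l ?card_rat_gt1 //; lia.
by exists p`_0; [rewrite -polyC_eq0 -size1_polyC | apply: size1_polyC].
Qed.

Lemma labs_fracpart f : labs (f - lpoly (lfloor f)) < 1.
Proof.
set g := f - _; have [->|g0] := eqVneq g 0; first by rewrite labs0.
have dg := ldegP g0; rewrite (is_ldeg_labs dg) -(expr0z #|F|%:R).
rewrite ltr_eXz2l ?card_rat_gt1 //.
case: dg; case: (ldeg g) => // n; rewrite /= coef_lfloor subrr eqxx //.
Qed.

End AbsoluteValue.

Section ContinuedFraction.
Variables (F : finFieldType) (f : laurent F).
Hypothesis f_irr : ~ rational_laurent f.
Implicit Types (n : nat) (B P Q U V : {poly F}).

Lemma pabs_cross U V P Q : V != 0 -> Q != 0 ->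
  pabs (U * Q - V * P) = pabs V * pabs Q *
    labs ((f - lpoly P / lpoly Q) - (f - lpoly U / lpoly V)).
Proof.
move=> V0 Q0; rewrite /pabs -!labsM rmorphB !rmorphM; congr labs.
by field; rewrite !lpoly_eq0 V0.
Qed.

Lemma rational_laurentDpoly (g : laurent F) B :
  rational_laurent g -> rational_laurent (g + lpoly B).
Proof.
move=> [U [V [V0 ->]]]; exists (U + B * V), V; split=> //.
by rewrite rmorphD rmorphM mulrDl mulfK // lpoly_eq0.
Qed.

Lemma rational_laurentV (g : laurent F) :
  rational_laurent g -> rational_laurent g^-1.
Proof.
move=> [U [V [V0 ->]]]; have [->|U0] := eqVneq U 0.
  by exists 0, 1; rewrite oner_neq0 rmorph0 !mul0r invr0.
by exists V, U; rewrite U0 invf_div.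
Qed.

Lemma cf_rem_irrational n : ~ rational_laurent (cf_rem f n).
Proof.
elim: n => [|n IH] /= rat_rem.
  by apply: f_irr; rewrite -(subrK (lpoly (lfloor f)) f); exact: rational_laurentDpoly.
apply: IH; rewrite -[cf_rem f n]invrK; apply: rational_laurentV.
by rewrite -[_^-1](subrK (lpoly (lfloor (cf_rem f n)^-1))); exact: rational_laurentDpoly.
Qed.

Lemma cf_rem_neq0 n : cf_rem f n != 0.
Proof.
apply/eqP => r0; apply: (@cf_rem_irrational n); rewrite r0.
by exists 0, 1; rewrite oner_neq0 rmorph0 mul0r.
Qed.

Lemma labs_cf_rem n : labs (cf_rem f n) < 1.
Proof. by case: n => [|n]; apply: labs_fracpart. Qed.

Lemma cf_remV n : (cf_rem f n)^-1 = lpoly (cf_pq f n.+1) + cf_rem f n.+1.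
Proof. by rewrite /= addrC subrK. Qed.

Lemma pabs_cf_pqS n : pabs (cf_pq f n.+1) = (labs (cf_rem f n))^-1.
Proof.
rewrite /pabs; have -> : lpoly (cf_pq f n.+1) = (cf_rem f n)^-1 - cf_rem f n.+1 :> laurent F.
  by rewrite cf_remV addrK.
rewrite -labsV; apply: labsDr; rewrite labsN labsV.
apply: lt_trans (labs_cf_rem _) _.
by rewrite invf_gt1 ?labs_gt0 ?cf_rem_neq0 ?labs_cf_rem.
Qed.

Lemma pabs_cf_pqS_gt1 n : 1 < pabs (cf_pq f n.+1).
Proof. by rewrite pabs_cf_pqS invf_gt1 ?labs_gt0 ?cf_rem_neq0 ?labs_cf_rem. Qed.

Lemma cf_num_shiftSS n : cf_num_shift f n.+2 =
  cf_pq f n.+1 * cf_num_shift f n.+1 + cf_num_shift f n.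
Proof. by []. Qed.

Lemma cf_den_shiftSS n : cf_den_shift f n.+2 =
  cf_pq f n.+1 * cf_den_shift f n.+1 + cf_den_shift f n.
Proof. by []. Qed.

Lemma pabs_mulD_den n B : pabs (cf_den_shift f n) < pabs (cf_den_shift f n.+1) ->
  1 <= pabs B -> pabs (B * cf_den_shift f n.+1 + cf_den_shift f n) =
    pabs B * pabs (cf_den_shift f n.+1).
Proof.
move=> lt_den B1; rewrite -pabsM /pabs rmorphD; apply: labsDr.
rewrite -/(pabs _) -/(pabs (B * _)) pabsM.
by apply: lt_le_trans lt_den _; rewrite ler_peMl ?labs_ge0.
Qed.

Lemma ltr_pabs_den n : pabs (cf_den_shift f n) < pabs (cf_den_shift f n.+1).
Proof.
elim: n => [|n IH].
  by rewrite /pabs /= rmorph0 rmorph1 labs0 labs1.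
rewrite [cf_den_shift f n.+2]cf_den_shiftSS.
rewrite pabs_mulD_den ?ltW ?pabs_cf_pqS_gt1 //.
by rewrite ltr_pMl ?pabs_cf_pqS_gt1 // (le_lt_trans _ IH) ?labs_ge0.
Qed.

Lemma pabs_denS_gt0 n : 0 < pabs (cf_den_shift f n.+1).
Proof. by apply: le_lt_trans (ltr_pabs_den n); rewrite labs_ge0. Qed.

Lemma pabs_denSS n : pabs (cf_den_shift f n.+2) =
  pabs (cf_pq f n.+1) * pabs (cf_den_shift f n.+1).
Proof.
rewrite cf_den_shiftSS pabs_mulD_den ?ltr_pabs_den //.
by rewrite ltW ?pabs_cf_pqS_gt1.
Qed.

Lemma cf_det n : cf_num_shift f n.+1 * cf_den_shift f n -
  cf_num_shift f n * cf_den_shift f n.+1 = (-1) ^+ n.+1.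
Proof.
elim: n => [|n IH]; first by rewrite /= mulr0 mul1r sub0r expr1.
by rewrite cf_num_shiftSS cf_den_shiftSS exprS -IH; ring.
Qed.

Lemma cf_complete n :
  f * (lpoly (cf_den_shift f n.+1) + cf_rem f n * lpoly (cf_den_shift f n)) =
  lpoly (cf_num_shift f n.+1) + cf_rem f n * lpoly (cf_num_shift f n).
Proof.
elim: n => [|n IH].
  by rewrite /= rmorph0 rmorph1 mulr0 addr0 !mulr1 addrC subrK.
have r0 := cf_rem_neq0 n.
have rS : cf_rem f n.+1 = (cf_rem f n)^-1 - lpoly (cf_pq f n.+1).
  by rewrite cf_remV addrC addKr.
rewrite cf_num_shiftSS cf_den_shiftSS !rmorphD !rmorphM rS.
apply: (mulfI r0); transitivity (lpoly (cf_num_shift f n.+1) +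
  cf_rem f n * lpoly (cf_num_shift f n)); last by field.
by rewrite -IH; field.
Qed.

Lemma labs_complete_den n :
  labs (lpoly (cf_den_shift f n.+1) + cf_rem f n * lpoly (cf_den_shift f n)) =
  pabs (cf_den_shift f n.+1).
Proof.
apply: labsDr; rewrite labsM -!/(pabs _).
apply: le_lt_trans (ltr_pabs_den n).
by rewrite ler_piMl ?labs_ge0 // ltW ?labs_cf_rem.
Qed.

Lemma labs_intermediate_error n B :
  cf_den_shift f n.+1 - B * cf_den_shift f n != 0 ->
  labs (f - lpoly (cf_num_shift f n.+1 - B * cf_num_shift f n)
            / lpoly (cf_den_shift f n.+1 - B * cf_den_shift f n)) =
  labs (lpoly B + cf_rem f n) /
    (pabs (cf_den_shift f n.+1) *
     pabs (cf_den_shift f n.+1 - B * cf_den_shift f n)).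
Proof.
rewrite -pabs_gt0 labs_gt0 -labs_complete_den -!labsM.
set D := lpoly _ + _ * _; set W := lpoly (_ - _) => W0.
have D0 : D != 0 by rewrite -labs_gt0 labs_complete_den pabs_denS_gt0.
rewrite -labsV -labsM -[RHS]mul1r -(labs_sign F n) -labsM; congr labs.
have fE : f = (lpoly (cf_num_shift f n.+1) +
  cf_rem f n * lpoly (cf_num_shift f n)) / D by rewrite -cf_complete mulfK.
apply: (mulIf (mulf_neq0 D0 W0)); rewrite [X in X - _]fE; rewrite -[RHS]mulrA divfK ?mulf_neq0 //.
transitivity ((lpoly (cf_num_shift f n.+1) +
  cf_rem f n * lpoly (cf_num_shift f n)) * W -
  lpoly (cf_num_shift f n.+1 - B * cf_num_shift f n) * D).
  by field; rewrite D0 -rmorphM -rmorphB W0.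
have -> : (-1) ^+ n = - lpoly ((-1) ^+ n.+1 : {poly F}) :> laurent F.
  by rewrite rmorphXn rmorphN rmorph1 exprS mulN1r opprK.
by rewrite -cf_det /W /D !rmorphB !rmorphM; ring.
Qed.

Lemma labs_convergent_error n :
  labs (f - lpoly (cf_num_shift f n.+1) / lpoly (cf_den_shift f n.+1)) =
  labs (cf_rem f n) / pabs (cf_den_shift f n.+1) ^+ 2.
Proof.
have := @labs_intermediate_error n 0; rewrite !mul0r !subr0 rmorph0 add0r.
by apply; rewrite -pabs_gt0 pabs_denS_gt0.
Qed.

End ContinuedFraction.

Theorem theorem4 (F : finFieldType) (f : laurent F)
    (hf : ~ rational_laurent f) (k : nat) :
  (forall B : {poly F}, B != 0 ->
      pabs B <= pabs (cf_pq f k.+1) ->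
      pabs (cf_pq f k.+1 - B) = pabs (cf_pq f k.+1) ->
    labs (f - lpoly (cf_num f k.+1 - B * cf_num f k)
              / lpoly (cf_den f k.+1 - B * cf_den f k))
      = pabs B / pabs (cf_den f k.+1) ^+ 2)
  /\
  (forall U V : {poly F}, V != 0 ->
      size V = size (cf_den f k.+1) ->
      labs (f - lpoly U / lpoly V)
        < 1 / (pabs (cf_den f k.+1) * pabs (cf_den f k)) ->
    exists B : {poly F},
      pabs B < pabs (cf_pq f k.+1) /\
      lpoly U / lpoly V = lpoly (cf_num f k.+1 - B * cf_num f k)
                          / lpoly (cf_den f k.+1 - B * cf_den f k)).
Proof.
rewrite /cf_num /cf_den.
set Q' := cf_den_shift f k.+2; set Q := cf_den_shift f k.+1.
set P' := cf_num_shift f k.+2; set P := cf_num_shift f k.+1.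
have Q_gt0 : 0 < pabs Q := pabs_denS_gt0 hf k.
have Q'_gt0 : 0 < pabs Q' := pabs_denS_gt0 hf k.+1.
have Q0 : Q != 0 by rewrite -pabs_gt0.
have Q'0 : Q' != 0 by rewrite -pabs_gt0.
have Q'E : pabs Q' = pabs (cf_pq f k.+1) * pabs Q := pabs_denSS hf k.
have A1 := pabs_cf_pqS_gt1 hf k.
split=> [B B0 _ AB|U V V0 szV].
  have QB : pabs (Q' - B * Q) = pabs Q'.
    have -> : Q' - B * Q = (cf_pq f k.+1 - B) * Q + cf_den_shift f k.
      by rewrite /Q' cf_den_shiftSS -/Q; ring.
    by rewrite pabs_mulD_den ?ltr_pabs_den // AB ?Q'E // ltW.
  rewrite labs_intermediate_error // -/Q' -/Q; last by rewrite -pabs_gt0 QB.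
  rewrite QB labsDr // -/(pabs B).
  by apply: lt_le_trans (labs_cf_rem f k.+1) _; exact: pabs_ge1.
have VE : pabs V = pabs Q' by rewrite !pabs_size // szV.
rewrite div1r => UV_lt.
pose a := U * Q - V * P; pose b := U * Q' - V * P'.
have a1 : pabs a = 1.
  have errP : labs (f - lpoly P / lpoly Q) = (pabs Q' * pabs Q)^-1.
    rewrite labs_convergent_error // -/Q Q'E pabs_cf_pqS //.
    by field; rewrite !gt_eqF // labs_gt0 cf_rem_neq0.
  rewrite (pabs_cross f) // labsDr ?labsN ?errP //.
  by rewrite VE mulfV // mulf_neq0 // gt_eqF.
have b_lt : pabs b < pabs (cf_pq f k.+1).
  have errP' : labs (f - lpoly P' / lpoly Q') < (pabs Q' * pabs Q)^-1.
    rewrite labs_convergent_error // -/Q'.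
    apply: (@lt_trans _ _ (1 / pabs Q' ^+ 2)).
      by rewrite ltr_pM2r ?labs_cf_rem // invr_gt0 exprn_gt0.
    rewrite div1r ltf_pV2 ?posrE ?exprn_gt0 ?mulr_gt0 //.
    by rewrite expr2 ltr_pM2l // ltr_pabs_den.
  rewrite (pabs_cross f) // VE.
  have -> : pabs (cf_pq f k.+1) = pabs Q' * pabs Q' * (pabs Q' * pabs Q)^-1.
    by rewrite Q'E; field; rewrite !gt_eqF // (lt_trans ltr01).
  by rewrite ltr_pM2l ?mulr_gt0 // labsD_lt // labsN.
have [c c0 ac] := pabs_eq1 a1.
have det : P' * Q - P * Q' = (-1) ^+ k.+2 := cf_det f k.+1.
have cV : c%:P * (c^-1)%:P = 1 :> {poly F} by rewrite -polyCM mulfV.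
exists ((c^-1)%:P * b); split; first by rewrite pabsM pabs_polyC ?invr_eq0 // mul1r.
have sU : (-1) ^+ k.+2 * U = c%:P * (P' - (c^-1)%:P * b * P).
  by rewrite mulrBr !mulrA cV mul1r -ac -det /a /b; ring.
have sV : (-1) ^+ k.+2 * V = c%:P * (Q' - (c^-1)%:P * b * Q).
  by rewrite mulrBr !mulrA cV mul1r -ac -det /a /b; ring.
rewrite -(lpoly_fracMl _ (B := (-1) ^+ k.+2)) ?signr_eq0 // sU sV.
by rewrite lpoly_fracMl // polyC_eq0.
Qed.
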